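(* Let $1\le k\le N$ and let $\lambda=(\lambda_1\ge\cdots\ge\lambda_N\ge0)$ be a signature of size $N$ with nonnegative coordinates. Then, as an identity of rational functions in $x_1,\dots,x_k$, $$\mathfrak X_\lambda(x_1,\dots,x_k;N,1)=\frac{\Delta_s^1(1^N)}{\Delta_s^1(x_1,\dots,x_k,1^{N-k})}\,(-1)^{\binom k2}\det\left[\left(x_i\frac{\partial}{\partial x_i}\right)^{2(j-1)}\right]_{i,j=1}^k\prod_{i=1}^k\mathfrak X_\lambda(x_i;N,1)\frac{(x_i-x_i^{-1})(2-x_i-x_i^{-1})^{N-1}}{2(2N-1)!},$$ where the determinant operator acts on the product over $i$ to its right.
   Context: Symplectic characters: for integers $\lambda_1\ge\cdots\ge\lambda_N\ge0$, $$\chi_\lambda(x_1,\dots,x_N)=\frac{\det\bigl[x_i^{\lambda_j+N+1-j}-x_i^{-(\lambda_j+N+1-j)}\bigr]_{i,j=1}^N}{\det\bigl[x_i^{N+1-j}-x_i^{-N-1+j}\bigr]_{i,j=1}^N}$$ (a Laurent polynomial), and $\mathfrak X_\lambda(x_1,\dots,x_k;N,1)=\chi_\lambda(x_1,\dots,x_k,1^{N-k})/\chi_\lambda(1^N)$, where $1^m$ stands for $m$ arguments equal to $1$. Put $$\Delta_s(x_1,\dots,x_k)=\prod_i(x_i-x_i^{-1})\prod_{i<j}\bigl(x_i+x_i^{-1}-(x_j+x_j^{-1})\bigr)$$ and, for $0\le k\le N$, $$\Delta_s^1(x_1,\dots,x_k,1^{N-k})=\Delta_s(x_1,\dots,x_k)\prod_{i=1}^k\frac{(x_i-1)^{2(N-k)}}{x_i^{N-k}}\prod_{1\le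 i<j\le N-k}(i^2-j^2)\;2^{N-k}(N-k)!$$ (empty products equal $1$; in particular $\Delta_s^1(1^N)=\prod_{1\le i<j\le N}(i^2-j^2)\,2^NN!$). *)

(* Defs.v *)
From HB Require Import structures.
From mathcomp Require Export all_boot all_order all_algebra perm.
From mathcomp Require Export generic_quotient fraction.
From mathcomp.multinomials Require Export mpoly.
From mathcomp Require Import ring.
From Stdlib Require Import ClassicalEpsilon.

Set Implicit Arguments.
Unset Strict Implicit.
Unset Printing Implicit Defensive.

Import GRing.Theory.
Local Open Scope ring_scope.

Notation "x %:F" := (@FracField.tofrac _ x) : ring_scope.

(* The field F(x_0, ..., x_(n-1)). *)
Notation "{ 'ratfun' F [ n ] }" := {fraction {mpoly F[n]}}
  (at level 0, F, n at level 2, format "{ 'ratfun'  F [ n ] }") : type_scope.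

Section RatFun.
Variables (F : fieldType) (n : nat).
Implicit Types (p q : {mpoly F[n]}) (f : {ratfun F[n]}) (v : 'I_n -> F).

Definition ratvar (i : 'I_n) : {ratfun F[n]} := ('X_i : {mpoly F[n]})%:F.

Definition has_ratval f v (y : F) : Prop :=
  exists p q, [/\ q.@[v] != 0, f = p%:F / q%:F & y = p.@[v] / q.@[v]].

(* The value of f at a point v where f is regular, that is, where some
   representation f = p / q has q(v) != 0.  By ratval_eq it does not depend on
   p and q; it is unspecified at the points where f is not regular. *)
Definition ratval f v : F := epsilon (inhabits 0) (has_ratval f v).

(* Quotient rule on a representative; see ratderiv_eq for independence. *)
Definition ratderiv (i : 'I_n) f : {ratfun F[n]} :=
  let p := \n_(repr f) in let q := \d_(repr f) in
  (p^`M(i) * q - p * q^`M(i))%:F / (q ^+ 2)%:F.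

Definition euler (i : 'I_n) f : {ratfun F[n]} := ratvar i * ratderiv i f.

Lemma frac_eq p1 q1 p2 q2 : q1 != 0 -> q2 != 0 ->
  (p1%:F / q1%:F == p2%:F / q2%:F) = (p1 * q2 == p2 * q1).
Proof.
by move=> q1N0 q2N0; rewrite eqr_div ?tofrac_eq0 // -!tofracM tofrac_eq.
Qed.

Lemma frac_repr f : f = (\n_(repr f))%:F / (\d_(repr f))%:F.
Proof.
have dN0 := denom_ratioP (repr f).
apply: (mulIf (x := (\d_(repr f))%:F)); first by rewrite tofrac_eq0.
rewrite divfK ?tofrac_eq0 // -{1}[f]reprK; unlock FracField.tofrac.
rewrite -[LHS]FracField.pi_mul; apply/eqmodP => /=.
by rewrite FracField.equivfE /FracField.mulf !numden_Ratio ?mulr1 ?oner_eq0 // mulrC.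
Qed.

Lemma ratval_eq p q v : q.@[v] != 0 ->
  ratval (p%:F / q%:F) v = p.@[v] / q.@[v].
Proof.
have nz r : r.@[v] != 0 -> r != 0 by apply: contraNneq => ->; rewrite meval0.
move=> qv; have : has_ratval (p%:F / q%:F) v (ratval (p%:F / q%:F) v).
  by apply: epsilon_spec; exists (p.@[v] / q.@[v]), p, q.
case=> p' [q' [q'v /eqP]]; rewrite frac_eq ?nz // => /eqP pq ->.
by apply/eqP; rewrite eqr_div // -!mevalM pq.
Qed.

Lemma ratderiv_eq i p q : q != 0 ->
  ratderiv i (p%:F / q%:F) = (p^`M(i) * q - p * q^`M(i))%:F / (q ^+ 2)%:F.
Proof.
move=> qN0; rewrite /ratderiv; set f := p%:F / q%:F.
have := frac_repr f; have := denom_ratioP (repr f).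
move: (\n_(repr f)) (\d_(repr f)) => a b bN0 /eqP; rewrite frac_eq // => /eqP e.
apply/eqP; rewrite frac_eq ?expf_neq0 //; apply/eqP.
have : p^`M(i) * b + p * b^`M(i) = a^`M(i) * q + a * q^`M(i).
  by rewrite -!mderivM e.
move: (p^`M(i)) (q^`M(i)) (a^`M(i)) (b^`M(i)) => p' q' a' b' e'.
transitivity (a' * q * (b * q) - a * q * (b' * q)); first by ring.
have -> : a' * q = p' * b + p * b' - a * q' by rewrite e' addrK.
transitivity (p' * b ^+ 2 * q + p * b * (b' * q) - a * q * (q' * b) - a * q * (b' * q)).
  by ring.
by rewrite -e; ring.
Qed.

End RatFun.

Arguments ratvar {F n} i.

(* Determinant of a matrix of commuting operators, acting on f. *)
Definition opdet (V : pzRingType) (n : nat) (A : 'M[V -> V]_n) (f : V) : V :=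
  \sum_(s : 'S_n) (-1) ^+ s * (\big[comp/id]_(i < n) A i (s i)) f.

Section Symplectic.
Variable K : fieldType.

(* chi_lambda, as an element of K(x_0, ..., x_(N-1)); with i and j counted
   from 0 the exponent lambda_j + N + 1 - j becomes lambda_j + N - j. *)
Definition schar (N : nat) (lam : N.-tuple nat) : {ratfun K[N]} :=
  let alt (l : 'I_N -> nat) : {ratfun K[N]} :=
    \det (\matrix_(i < N, j < N) (ratvar i ^+ l j - ratvar i ^- l j)) in
  alt (fun j => tnth lam j + N - j)%N / alt (fun j => N - j)%N.

(* chi_lambda(x_1, ..., x_k, 1^(N-k)).  As chi_lambda is a Laurent polynomial,
   it is regular at the points with nonzero coordinates. *)
Definition schar1 (N : nat) (lam : N.-tuple nat) (k : nat) (x : k.-tuple K) : K :=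
  ratval (schar lam) (fun i => nth 1 x i).

(* chi_lambda(x_1, ..., x_k, 1^(N-k)) / chi_lambda(1^N) *)
Definition nschar (N : nat) (lam : N.-tuple nat) (k : nat) (x : k.-tuple K) : K :=
  schar1 lam x / schar1 lam [tuple].

Definition Delta_s (k : nat) (x : k.-tuple K) : K :=
  \prod_(i < k) (tnth x i - (tnth x i)^-1) *
  \prod_(i < k) \prod_(j < k | (i < j)%N)
    (tnth x i + (tnth x i)^-1 - (tnth x j + (tnth x j)^-1)).

(* Delta_s^1(x_1, ..., x_k, 1^(N-k)), meant for k <= N. *)
Definition Delta_s1 (N k : nat) (x : k.-tuple K) : K :=
  Delta_s x *
  \prod_(i < k) ((tnth x i - 1) ^+ (2 * (N - k)) / tnth x i ^+ (N - k)) *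
  \prod_(1 <= i < (N - k).+1) \prod_(i.+1 <= j < (N - k).+1)
    (i%:R ^+ 2 - j%:R ^+ 2) *
  (2 ^ (N - k) * (N - k)`!)%:R.

End Symplectic.

(* Main.v *)
Require Import Defs.
From mathcomp Require Import all_boot all_order all_algebra perm.
From mathcomp Require Import generic_quotient fraction.
From mathcomp.multinomials Require Import mpoly.
From mathcomp Require Import ring zify.

(* Put w = x + 1/x - 2 and l_j = lambda_j + N + 1 - j.  Then x^l - x^-l is
   x - 1/x times sum_d C(l + d, 2d + 1) w^d.  Newton interpolation at the nodes
   w_1, ..., w_N factors the numerator of chi_lambda as prod (x_i - 1/x_i), times
   the Vandermonde product of the w_i, times a determinant that is polynomial in
   the w_i.  The last factor is chi_lambda, and it can be evaluated where nodes
   coincide: at w_(k+1) = ... = w_N = 0 (x_i = 1) its rows i > k become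
   (C(l_j + N - i, 2(N - i) + 1))_j.
   Turn the rows i <= k back into (x_i^(l_j) - x_i^(-l_j))_j with the Newton
   factors, and multiply on the right by the matrix of entries a_j l_j^(2m),
   where a_j = 1 / (l_j prod_(i <> j) (l_j^2 - l_i^2)).  Since C(l + d, 2d + 1) is l
   times a polynomial of degree d in l^2, Lagrange interpolation makes the product
   block triangular, with the k x k block (x d/dx)^(2m) G (x_i) where
   G(x) = sum_j a_j (x^(l_j) - x^(-l_j)).  The right factor is the same for all
   k, so comparing k with 0 gives X_lambda(x_1, ..., x_k; N, 1), and comparing
   1 with 0 identifies G with the one-variable function in the statement. *)

Set Implicit Arguments.
Unset Strict Implicit.
Unset Printing Implicit Defensive.

Import GRing.Theory.
Local Open Scope ring_scope.

(** * Newton interpolation of alternants *)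

Section Newton.
Variable R : comPzRingType.
Implicit Types (w : nat -> R) (N d m : nat).

(* [newt N w d m] is the coefficient of [\prod_(m < r < N) (t - w r)] in the Newton
   expansion of [t ^+ d]: the nodes are taken from the last one down. *)
Fixpoint newt N w d m : R :=
  if d is e.+1 then w m * newt N w e m + newt N w e m.+1 else (m.+1 == N)%:R.

Lemma newt_oversize N w d m : (N <= m)%N -> newt N w d m = 0.
Proof.
elim: d m => [|d IHd] m leNm /=; first by rewrite (_ : _ == _ = false) //; lia.
by rewrite !IHd ?mulr0 ?addr0 //; lia.
Qed.

Lemma newt_low N w d m : ((m + d).+1 <= N)%N ->
  newt N w d m = ((m + d).+1 == N)%:R.
Proof.
elim: d m => [|d IHd] m ltmN /=; first by rewrite addn0.
rewrite !IHd; [|lia|lia]; rewrite (_ : (m + d).+1 == N = false) ?mulr0 ?add0r; last lia.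
by rewrite addSnnS.
Qed.

Lemma newt_null N w k d m : (forall r, (k <= r)%N -> w r = 0) -> (k <= m)%N ->
  newt N w d m = ((m + d).+1 == N)%:R.
Proof.
move=> w0; elim: d m => [|d IHd] m lekm /=; first by rewrite addn0.
by rewrite w0 // mul0r add0r IHd ?addSnnS //; lia.
Qed.

Lemma newton_expansion N w d i : (i < N)%N ->
  w i ^+ d = \sum_(m < N) newt N w d m * \prod_(m.+1 <= r < N) (w i - w r).
Proof.
move=> ltiN; elim: d => [|d IHd].
  case: N ltiN => // N _; rewrite big_ord_recr /= big1 ?add0r.
    by rewrite eqxx big_geq // mulr1.
  by move=> m _; rewrite eqSS (_ : _ == _ = false) ?mul0r //=; have := ltn_ord m; lia.
rewrite exprS {}IHd mulr_sumr.
have step m : w i * (newt N w d m * \prod_(m.+1 <= r < N) (w i - w r)) =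
    w m * newt N w d m * \prod_(m.+1 <= r < N) (w i - w r) +
    newt N w d m * ((w i - w m) * \prod_(m.+1 <= r < N) (w i - w r)) by ring.
under eq_bigr => m _ do rewrite step.
rewrite big_split /=.
under [RHS]eq_bigr => m _ do rewrite mulrDl.
rewrite [RHS]big_split /=; congr (_ + _).
case: N ltiN {step} => // N ltiN.
rewrite big_ord_recl big_ord_recr /= [newt _ _ _ N.+1]newt_oversize // mul0r addr0.
rewrite -(big_ltn (F := fun r => w i - w r)) // (big_cat_nat (n := i)) ?(ltnW ltiN) //=.
rewrite (big_ltn ltiN) subrr mul0r !mulr0 add0r; apply: eq_bigr => m _.
by rewrite /bump /= add1n -big_ltn //; have := ltn_ord m; lia.
Qed.

End Newton.

Definition wcoord (K : fieldType) (x : K) : K := x + x^-1 - 2.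

Lemma bin_second_difference l d :
  ('C(l.+2 + d.+1, d.+1.*2.+1) + 'C(l + d.+1, d.+1.*2.+1) =
   'C(l.+1 + d, d.*2.+1) + 2 * 'C(l.+1 + d.+1, d.+1.*2.+1))%N.
Proof. by rewrite doubleS !addnS !addSn !binS; lia. Qed.

Lemma expr_subV (K : fieldType) (x : K) l B : x != 0 -> (l <= B)%N ->
  x ^+ l - x ^- l =
  (x - x^-1) * \sum_(d < B) wcoord x ^+ d * 'C(l + d, d.*2.+1)%:R.
Proof.
move=> x0; set w := wcoord x.
pose S m := \sum_(d < B) w ^+ d * 'C(m + d, d.*2.+1)%:R.
have S_step m : (m.+2 <= B)%N -> S m.+2 + S m = (w + 2) * S m.+1.
  rewrite /S; case: B {S} => // C ltmC; rewrite mulrDl [X in _ = X + _]mulr_sumr.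
  rewrite [X in _ = X + _]big_ord_recr /= [X in _ = _ + X + _]mulrCA.
  rewrite [X in _ = _ + _ * X + _](_ : _ = 0); last first.
    by rewrite bin_small ?mulr0 //; lia.
  rewrite mulr0 addr0 !big_ord_recl !addn0 !bin1 !expr0 !mul1r.
  rewrite addrACA mulrDr [in RHS]addrCA; congr (_ + _).
    by rewrite -!natrD -natrM; congr _%:R; lia.
  rewrite mulr_sumr -!big_split; apply: eq_bigr => d _ /=.
  rewrite /bump /= !add1n mulrA [w * _]mulrC -exprSr [2 * _]mulrCA -!mulrDr.
  by rewrite -natrM -!natrD bin_second_difference.
suff e m : (m <= B)%N -> x ^+ m - x ^- m = (x - x^-1) * S m by apply: e.
elim/ltn_ind: m => -[|[|m]] IH leB.
- by rewrite expr0 invr1 subrr /S big1 ?mulr0 // => d _; rewrite bin_small ?mulr0 //; lia.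
- rewrite expr1 /S; case: B leB {S S_step IH} => // C _; rewrite big_ord_recl big1; last first.
    by move=> d _; rewrite bin_small ?mulr0 // /=  /bump; lia.
  by rewrite expr0 bin1 addr0 !mulr1.
have -> : S m.+2 = (w + 2) * S m.+1 - S m by rewrite -S_step ?addrK.
rewrite mulrBr mulrCA -!IH; [|lia..].
rewrite /w /wcoord subrK !exprS !invfM -!exprVn mulrDl !mulrBr !mulrA mulVf // divff //.
by ring.
Qed.

Definition newton_mx (R : comPzRingType) N (w : nat -> R) B (l : 'I_N -> nat) :
  'M[R]_N :=
  \matrix_(m, j) \sum_(d < B) newt N w d m * 'C(l j + d, d.*2.+1)%:R.

Lemma det_upper_trig (R : comPzRingType) n (A : 'M[R]_n) :
  (forall i j : 'I_n, (j < i)%N -> A i j = 0) -> \det A = \prod_(i < n) A i i.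
Proof.
move=> A0; rewrite -det_tr det_trig; first by under eq_bigr do rewrite mxE.
by apply/is_trig_mxP => i j ltij; rewrite mxE A0.
Qed.

Lemma det_alternant (K : fieldType) N k (x : nat -> K) B (l : 'I_N -> nat) :
  (forall i, (i < k)%N -> x i != 0) -> (forall j, (l j <= B)%N) ->
  let w i := wcoord (x i) in
  \det (\matrix_(i < N, j < N)
    if (i < k)%N then x i ^+ l j - x i ^- l j else newton_mx w B l i j) =
  (\prod_(i < N | (i < k)%N)
    ((x i - (x i)^-1) * \prod_(i.+1 <= r < N) (w i - w r))) *
  \det (newton_mx w B l).
Proof.
move=> x0 leB w.
pose L := \matrix_(i < N, m < N)
  if (i < k)%N then (x i - (x i)^-1) * \prod_(m.+1 <= r < N) (w i - w r)
  else (m == i)%:R.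
rewrite [X in \det X](_ : _ = L *m newton_mx w B l).
  rewrite det_mulmx det_upper_trig.
    congr (_ * _); rewrite [RHS]big_mkcond; apply: eq_bigr => i _.
    by rewrite !mxE eqxx.
  move=> i m ltmi; rewrite mxE; case: ifP => _; last by rewrite -val_eqE ltn_eqF.
  by rewrite (bigD1_seq (i : nat)) ?mem_index_iota ?iota_uniq ?ltmi ?ltn_ord //=
    subrr mul0r mulr0.
apply/matrixP => i j; rewrite !mxE; case: ltnP => [ltik|leki].
  rewrite (expr_subV (x0 i ltik) (leB j)) -/(w i) mulr_sumr.
  under [RHS]eq_bigr => m _ do rewrite !mxE ltik mulr_sumr.
  rewrite exchange_big /=; apply: eq_bigr => d _.
  rewrite (newton_expansion w d (ltn_ord i)) mulr_suml mulr_sumr.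
  by apply: eq_bigr => m _; ring.
rewrite [RHS](bigD1 i) //= [X in _ = _ + X]big1 ?addr0 => [|m /negPf neq].
  by rewrite !mxE ltnNge leki eqxx mul1r.
by rewrite !mxE ltnNge leki neq mul0r.
Qed.

Lemma det_newton_rho (R : comPzRingType) N (w : nat -> R) B : (N <= B)%N ->
  \det (newton_mx w B (fun j : 'I_N => N - j)%N) = 1.
Proof.
move=> leNB.
have small (m j : 'I_N) d : (m <= j)%N -> d != (N.-1 - m)%N :> nat ->
    newt N w d m * 'C(N - j + d, d.*2.+1)%:R = 0.
  move=> lemj neq; have [ltN|leN] := leqP (m + d).+1 N.
    by rewrite newt_low // (_ : _ == _ = false) ?mul0r //; lia.
  by rewrite bin_small ?mulr0 //; lia.
rewrite det_trig ?big1 // => [i _|].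
  rewrite mxE; have ltB : (N.-1 - i < B)%N by have := ltn_ord i; lia.
  rewrite (bigD1 (Ordinal ltB)) //= big1 ?addr0 => [|d neq]; last by rewrite small.
  have -> : (N - i + (N.-1 - i) = (N.-1 - i).*2.+1)%N by have := ltn_ord i; lia.
  rewrite binn mulr1 newt_low; first by rewrite (_ : _ == _) //; have := ltn_ord i; lia.
  by have := ltn_ord i; lia.
apply/is_trig_mxP => i j ltij; rewrite mxE big1 // => d _.
have [eqd|] := eqVneq (d : nat) (N.-1 - i)%N; last by apply: small; exact: ltnW.
by rewrite bin_small ?mulr0 // eqd; have := ltn_ord j; lia.
Qed.

(** * Values of rational functions at regular points *)

Section RegularValues.
Variables (K : fieldType) (n : nat) (v : 'I_n -> K).
Implicit Types (f g : {ratfun K[n]}) (a b : K).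

Lemma has_ratval_ratval f a : has_ratval f v a -> ratval f v = a.
Proof. by case=> p [q [qv -> ->]]; apply: ratval_eq. Qed.

Lemma has_ratval_denom (q : {mpoly K[n]}) : q.@[v] != 0 -> q%:F != 0.
Proof. by move=> qv; rewrite tofrac_eq0; apply: contraNneq qv => ->; rewrite meval0. Qed.

Lemma has_ratval_poly (p : {mpoly K[n]}) : has_ratval p%:F v p.@[v].
Proof. by exists p, 1; rewrite tofrac1 meval1 !divr1 oner_eq0. Qed.

Lemma has_ratval_nat m : has_ratval (m%:R) v m%:R.
Proof. by have := has_ratval_poly m%:R; rewrite !rmorph_nat. Qed.

Lemma has_ratval_var i : has_ratval (ratvar i) v (v i).
Proof. by have := has_ratval_poly 'X_i; rewrite mevalXU. Qed.

Lemma has_ratvalD f g a b :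
  has_ratval f v a -> has_ratval g v b -> has_ratval (f + g) v (a + b).
Proof.
case=> p [q [qv -> ->]] [p' [q' [q'v -> ->]]].
exists (p * q' + p' * q), (q * q'); split; first by rewrite mevalM mulf_neq0.
  by rewrite addf_div ?has_ratval_denom // !rmorphD !rmorphM.
by rewrite addf_div // mevalD !mevalM.
Qed.

Lemma has_ratvalM f g a b :
  has_ratval f v a -> has_ratval g v b -> has_ratval (f * g) v (a * b).
Proof.
case=> p [q [qv -> ->]] [p' [q' [q'v -> ->]]].
exists (p * p'), (q * q'); split; first by rewrite mevalM mulf_neq0.
  by rewrite mulf_div !rmorphM.
by rewrite mulf_div !mevalM.
Qed.

Lemma has_ratvalN f a : has_ratval f v a -> has_ratval (- f) v (- a).
Proof.
case=> p [q [qv -> ->]]; exists (- p), q.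
by rewrite rmorphN mevalN !mulNr.
Qed.

Lemma has_ratvalV f a : a != 0 -> has_ratval f v a -> has_ratval f^-1 v a^-1.
Proof.
move=> a0 [p [q [qv -> ae]]]; exists q, p; rewrite ae !invf_div; split=> //.
by apply: contraNneq a0; rewrite ae => ->; rewrite mul0r.
Qed.

Lemma has_ratval_sum (I : Type) (r : seq I) (P : pred I)
    (f_ : I -> {ratfun K[n]}) (a_ : I -> K) :
  (forall i, P i -> has_ratval (f_ i) v (a_ i)) ->
  has_ratval (\sum_(i <- r | P i) f_ i) v (\sum_(i <- r | P i) a_ i).
Proof.
move=> fa; apply: (big_rec2 (fun f a => has_ratval f v a)) => [|i f a Pi].
  exact: (has_ratval_nat 0).
by apply: has_ratvalD; apply: fa.
Qed.

Lemma has_ratval_prod (I : Type) (r : seq I) (P : pred I)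
    (f_ : I -> {ratfun K[n]}) (a_ : I -> K) :
  (forall i, P i -> has_ratval (f_ i) v (a_ i)) ->
  has_ratval (\prod_(i <- r | P i) f_ i) v (\prod_(i <- r | P i) a_ i).
Proof.
move=> fa; apply: (big_rec2 (fun f a => has_ratval f v a)) => [|i f a Pi].
  exact: (has_ratval_nat 1).
by apply: has_ratvalM; apply: fa.
Qed.

Lemma has_ratval_det m (A : 'M[{ratfun K[n]}]_m) (A' : 'M[K]_m) :
  (forall i j, has_ratval (A i j) v (A' i j)) -> has_ratval (\det A) v (\det A').
Proof.
move=> AA'; apply: has_ratval_sum => s _; apply: has_ratvalM.
  by case: (s : bool); [apply/has_ratvalN/(has_ratval_nat 1)|apply: (has_ratval_nat 1)].
by apply: has_ratval_prod.
Qed.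

Lemma has_ratval_newt N (w : nat -> {ratfun K[n]}) (w' : nat -> K) d m :
  (forall i, has_ratval (w i) v (w' i)) ->
  has_ratval (newt N w d m) v (newt N w' d m).
Proof.
move=> ww'; elim: d m => [|d IHd] m; first exact: has_ratval_nat.
by apply: has_ratvalD; first apply: has_ratvalM.
Qed.

Lemma has_ratval_wcoord f a : a != 0 ->
  has_ratval f v a -> has_ratval (wcoord f) v (wcoord a).
Proof.
move=> a0 fa; apply: has_ratvalD; last exact/has_ratvalN/(has_ratval_nat 2).
by apply: has_ratvalD => //; apply: has_ratvalV.
Qed.

End RegularValues.

Section RatfunVariables.
Variables (K : fieldType) (n : nat).
Notation x i := (ratvar i : {ratfun K[n]}).

Lemma ratvar_neq0 i : x i != 0.
Proof.
apply: (@has_ratval_denom _ _ (fun=> 1)).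
by rewrite mevalXU oner_eq0.
Qed.

Lemma ratvarM_neq1 i j : x i * x j != 1.
Proof.
rewrite /ratvar -rmorphM -tofrac1 tofrac_eq; apply/eqP => /(congr1 (meval (fun=> 0))).
by rewrite mevalM mevalXU mul0r meval1 => /esym/eqP; rewrite oner_eq0.
Qed.

Lemma ratvar_inj i j : x i = x j -> i = j.
Proof.
move/eqP; rewrite tofrac_eq => /eqP/(congr1 (meval (fun m => (m == i)%:R))).
by rewrite !mevalXU eqxx; case: eqVneq => // _ /eqP; rewrite oner_eq0.
Qed.

End RatfunVariables.

Lemma subV_neq0 (K : fieldType) (x : K) : x != 0 -> x * x != 1 -> x - x^-1 != 0.
Proof.
move=> x0; apply: contraNneq => /eqP; rewrite subr_eq0 => /eqP {2}->.
by rewrite divff.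
Qed.

Lemma wcoord_eq (K : fieldType) (x y : K) : x != 0 -> y != 0 ->
  (wcoord x == wcoord y) = (x == y) || (x * y == 1).
Proof.
move=> x0 y0; rewrite -subr_eq0.
have -> : wcoord x - wcoord y = (x - y) * (x * y - 1) / (x * y).
  by rewrite /wcoord; field; rewrite ?x0 ?y0.
by rewrite !mulf_eq0 invr_eq0 (negPf (mulf_neq0 x0 y0)) orbF !subr_eq0.
Qed.

Section Values.
Variables (K : fieldType) (N : nat) (lam : N.-tuple nat) (B : nat).
Let l (j : 'I_N) := (tnth lam j + N - j)%N.
Hypothesis leB : forall j, (l j <= B)%N.

Lemma leq_size_bound : (N <= B)%N.
Proof. by case: N lam @l leB => // m t l' /(_ ord0); rewrite /l' subn0; lia. Qed.

Lemma scharE (y := fun i => nth 1 [tuple ratvar i : {ratfun K[N]} | i < N] i) :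
  schar K lam = \det (newton_mx (fun i => wcoord (y i)) B l).
Proof.
have yE (i : 'I_N) : y i = ratvar i by rewrite /y -tnth_nth tnth_mktuple.
have y0 i : (i < N)%N -> y i != 0.
  by move=> ltiN; rewrite (yE (Ordinal ltiN)) ratvar_neq0.
have altE (m : 'I_N -> nat) : (forall j, (m j <= B)%N) ->
    \det (\matrix_(i < N, j < N) (ratvar i ^+ m j - ratvar i ^- m j)) =
    (\prod_(i < N | (i < N)%N) ((y i - (y i)^-1) *
      \prod_(i.+1 <= r < N) (wcoord (y i) - wcoord (y r)))) *
    \det (newton_mx (fun i => wcoord (y i)) B m).
  move=> leB'; rewrite -(det_alternant y0 leB'); congr (\det _).
  by apply/matrixP => i j; rewrite !mxE ltn_ord yE.
rewrite /schar altE // altE => [|j]; last by have := leq_size_bound; lia.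
rewrite det_newton_rho ?leq_size_bound // mulr1 mulrC mulKf //.
apply/prodf_neq0 => i _; rewrite mulf_neq0 //.
  by rewrite yE subV_neq0 ?ratvar_neq0 ?ratvarM_neq1.
rewrite prodf_seq_neq0; apply/allP => r; rewrite mem_index_iota => /andP[ltir ltrN].
rewrite subr_eq0 wcoord_eq ?y0 // yE (yE (Ordinal ltrN)).
rewrite (negPf (ratvarM_neq1 _ _ _)) orbF.
by apply/eqP => /ratvar_inj eqi; move: ltir; rewrite eqi ltnn.
Qed.

Lemma schar1E k (x : k.-tuple K) : (k <= N)%N -> (forall i, tnth x i != 0) ->
  schar1 lam x = \det (newton_mx (fun i => wcoord (nth 1 x i)) B l).
Proof.
move=> leN x0; apply: has_ratval_ratval; rewrite scharE.
apply: has_ratval_det => i j; rewrite !mxE.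
apply: has_ratval_sum => d _; apply: has_ratvalM; last exact: has_ratval_nat.
apply: has_ratval_newt => r; apply: has_ratval_wcoord.
  have [ltrk|lekr] := ltnP r k; last by rewrite nth_default ?size_tuple ?oner_eq0.
  by rewrite -[r]/(val (Ordinal ltrk)) -tnth_nth.
have [ltrN|leNr] := ltnP r N.
  have := has_ratval_var (fun i : 'I_N => nth 1 x i) (Ordinal ltrN).
  by rewrite -[X in nth _ [tuple _ | _ < _] X]/(val (Ordinal ltrN)) -tnth_nth tnth_mktuple.
rewrite !nth_default ?size_tuple //; [exact: (has_ratval_nat _ 1)|exact: leq_trans leNr].
Qed.

End Values.

(** * Determinants in the variables l_j^2 *)

Lemma lagrange_lead_coef (K : fieldType) N (s : 'I_N -> K) (q : {poly K}) :
  injective s -> (size q <= N)%N ->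
  \sum_j q.[s j] / \prod_(i | i != j) (s j - s i) = q`_N.-1.
Proof.
move=> s_inj le_q.
pose D j := \prod_(i | i != j) (s j - s i).
have D0 j : D j != 0.
  by apply/prodf_neq0 => i; rewrite subr_eq0 eq_sym; apply: contraNneq => /s_inj->.
pose b j := \prod_(i | i != j) ('X - (s i)%:P).
have bE j : b j = \prod_(i <- enum (predC1 j)) ('X - (s i)%:P) by rewrite big_enum.
have size_b j : size (b j) = N.
  by rewrite bE size_prod_XsubC -cardE cardC1 card_ord prednK ?(leq_ltn_trans _ (ltn_ord j)).
have qE : q = \sum_j (q.[s j] / D j) *: b j.
  apply/eqP; rewrite -subr_eq0; apply/eqP.
  apply: (@roots_geq_poly_eq0 _ _ [seq s i | i <- enum 'I_N]).
  - apply/allP => _ /mapP[i _ ->]; rewrite rootE hornerD hornerN horner_sum.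
    rewrite (bigD1 i) //= big1 ?addr0 => [|j neq].
      rewrite hornerZ horner_prod -[X in _ / _ * X](_ : D i = _) ?divfK ?subrr //.
      by apply: eq_bigr => j _; rewrite hornerXsubC.
    rewrite hornerZ horner_prod (bigD1 i) 1?eq_sym //= hornerXsubC subrr.
    by rewrite mul0r mulr0.
  - by rewrite map_inj_uniq ?enum_uniq.
  rewrite size_map size_enum_ord; apply: leq_trans (size_polyD _ _) _.
  rewrite geq_max le_q size_polyN; apply: leq_trans (size_sum _ _ _) _.
  by apply/bigmax_leqP => j _; rewrite (leq_trans (size_scale_leq _ _)) ?size_b.
rewrite [in RHS]qE coef_sum; apply: eq_bigr => j _; rewrite coefZ.
have -> : (b j)`_N.-1 = 1.
  by rewrite -[X in _`_X.-1](size_b j) -lead_coefE bE; apply/monicP/monic_prod_XsubC.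
by rewrite mulr1.
Qed.

Lemma bin_ffact_squares (R : comPzRingType) l d :
  'C(l + d, d.*2.+1)%:R * (d.*2.+1)`!%:R =
  l%:R * \prod_(1 <= r < d.+1) (l%:R ^+ 2 - r%:R ^+ 2) :> R.
Proof.
rewrite -natrM bin_ffact; elim: d => [|d IHd].
  by rewrite addn0 ffactn1 big_geq ?mulr1.
rewrite big_nat_recr //= mulrA -{}IHd addnS doubleS ffactnS ffactnSr /=.
have [leld|ltdl] := leqP l d.
  by rewrite !ffact_small ?mul0n ?muln0 ?mul0r //; lia.
rewrite (_ : (l + d - d.*2.+1 = l - d.+1)%N); last lia.
rewrite 2!natrM natrB // -addnS natrD; ring.
Qed.

Lemma det_upper_block (R : comPzRingType) N k (lekN : (k <= N)%N) (A : 'M[R]_N) :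
  (forall i j : 'I_N, (k <= i)%N -> (j < i)%N -> A i j = 0) ->
  \det A = \det (\matrix_(i < k, j < k) A (widen_ord lekN i) (widen_ord lekN j)) *
    \prod_(i < N | (k <= i)%N) A i i.
Proof.
move: (lekN); rewrite -(subnKC lekN) in A *; move: (N - k)%N A => n A le A0.
rewrite -{1}[A]submxK; have -> : dlsubmx A = 0.
  by apply/matrixP => i j; rewrite !mxE A0 //= ?leq_addr // ltn_addr.
rewrite det_ublock [\det (drsubmx A)]det_upper_trig => [|i j ltji]; last first.
  by rewrite !mxE A0 //= ?leq_addr // ltn_add2l.
congr (_ * _).
  by congr (\det _); apply/matrixP => i j; rewrite !mxE; congr (A _ _); apply: val_inj.
rewrite big_split_ord /= [X in X * _]big1 ?mul1r => [|i]; last first.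
  by rewrite leqNgt ltn_ord.
by rewrite [RHS]big_mkcond; apply: eq_bigr => i _; rewrite leq_addr !mxE.
Qed.

Lemma prod_wcoord_Delta_s (K : fieldType) N k (x : k.-tuple K) : (k <= N)%N ->
  let y i := nth 1 x i in
  \prod_(i < N | (i < k)%N) ((y i - (y i)^-1) *
     \prod_(i.+1 <= r < N) (wcoord (y i) - wcoord (y r))) =
  Delta_s x * \prod_(i < k) wcoord (tnth x i) ^+ (N - k).
Proof.
move=> lekN y; have yE (i : 'I_k) : y i = tnth x i by rewrite (tnth_nth 1).
rewrite (big_ord_narrow lekN) /= big_split /= /Delta_s -mulrA -[in RHS]big_split /=.
congr (_ * _); first by apply: eq_bigr => i _; rewrite yE.
apply: eq_bigr => i _; rewrite (big_cat_nat (n := k)) //=; congr (_ * _).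
  rewrite big_geq_mkord; apply: eq_bigr => j _.
  by rewrite /wcoord !yE; ring.
rewrite -yE; transitivity (\prod_(k <= r < N) wcoord (y i)); last by rewrite prodr_const_nat.
apply: eq_big_nat => r /andP[lekr _]; rewrite [y r]nth_default ?size_tuple //.
by rewrite /wcoord invr1 (_ : 1 + 1 - 2 = 0) ?subr0 //; ring.
Qed.

Lemma natr_neq0_pchar0 (K : fieldType) (charK : [pchar K] =i pred0) m :
  (0 < m)%N -> m%:R != 0 :> K.
Proof. by move=> m0; have /pcharf0P -> := charK; rewrite -lt0n. Qed.

Section Determinants.
Variables (K : fieldType) (charK : [pchar K] =i pred0).
Variables (N : nat) (l : 'I_N -> nat) (l_gt0 : forall j, (0 < l j)%N).
Variable (l_inj : injective l).

Definition lweight (j : 'I_N) : K :=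
  ((l j)%:R * \prod_(i | i != j) ((l j)%:R ^+ 2 - (l i)%:R ^+ 2))^-1.

Definition lsum m (y : K) : K :=
  \sum_j lweight j * (l j)%:R ^+ (2 * m) * (y ^+ l j - y ^- l j).

Definition lweight_mx : 'M[K]_N := \matrix_(j, m) (lweight j * (l j)%:R ^+ (2 * m)).

Lemma sqr_natr_inj : injective (fun j => (l j)%:R ^+ 2 : K).
Proof.
move=> i j /eqP; rewrite -!natrX; move: (leq_total (l i) (l j)).
wlog le_ij : i j / (l i <= l j)%N => [IH /orP[]le e|_].
- by apply: IH => //; rewrite le.
- by apply/esym/IH; rewrite ?le // eq_sym.
rewrite eq_sym -subr_eq0 -natrB ?leq_sqr // => e; apply: l_inj; apply/eqP.
rewrite eqn_leq le_ij /= leqNgt; apply: contraL e => lt_ij.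
by apply: (natr_neq0_pchar0 charK); rewrite subn_gt0 ltn_sqr.
Qed.

Lemma lweight_bin_sum d m : (m + d < N)%N ->
  \sum_j 'C(l j + d, d.*2.+1)%:R * (lweight j * (l j)%:R ^+ (2 * m)) =
  ((m + d).+1 == N)%:R / (d.*2.+1)`!%:R.
Proof.
move=> ltN; pose q : {poly K} := \prod_(1 <= r < d.+1) ('X - (r%:R ^+ 2)%:P).
have q_monic : q \is monic by apply: monic_prod_XsubC.
have size_q : size q = d.+1 by rewrite size_prod_XsubC size_iota subn1.
have size_qX : size (q * 'X^m) = (m + d).+1.
  by rewrite size_monicM ?monicXn ?size_polyXn ?monic_neq0 ?monicXn // size_q /=; lia.
have fact0 : (d.*2.+1)`!%:R != 0 :> K by rewrite (natr_neq0_pchar0 charK) ?fact_gt0.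
have := lagrange_lead_coef (q := q * 'X^m) sqr_natr_inj.
rewrite size_qX => /(_ ltN); have -> : (q * 'X^m)`_N.-1 = ((m + d).+1 == N)%:R.
  case: eqVneq => [eN|neN].
    have /monicP : q * 'X^m \is monic by rewrite monicMr ?monicXn.
    by rewrite lead_coefE size_qX -eN.
  by rewrite nth_default // size_qX; lia.
move <-; rewrite mulr_suml; apply: eq_bigr => j _.
apply: (mulIf fact0); rewrite divfK // mulrAC bin_ffact_squares /lweight invfM.
rewrite hornerM hornerXn horner_prod -exprM.
have -> : \prod_(1 <= r < d.+1) ('X - (r%:R ^+ 2)%:P).[(l j)%:R ^+ 2] =
   \prod_(1 <= r < d.+1) ((l j)%:R ^+ 2 - r%:R ^+ 2) :> K.
  by apply: eq_bigr => r _; rewrite hornerXsubC.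
by rewrite mulrACA [X in X * _]mulrA divff ?(natr_neq0_pchar0 charK) // mul1r mulrC.
Qed.

Lemma det_alternant_lweight k (lekN : (k <= N)%N) (y : nat -> K) B :
  (forall j, l j <= B)%N -> (N <= B)%N ->
  (forall r, (k <= r)%N -> wcoord (y r) = 0) ->
  \det (\matrix_(i < N, j < N)
    if (i < k)%N then y i ^+ l j - y i ^- l j
    else newton_mx (fun i => wcoord (y i)) B l i j) * \det lweight_mx =
  \det (\matrix_(i < k, m < k) lsum m (y i)) *
  \prod_(i < N | (k <= i)%N) ((N.-1 - i).*2.+1)`!%:R^-1.
Proof.
move=> leB leNB y1.
have newton_tail (i j : 'I_N) : (k <= i)%N ->
    newton_mx (fun i => wcoord (y i)) B l i j =
    'C(l j + (N.-1 - i), (N.-1 - i).*2.+1)%:R.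
  move=> leki; have ltd : (N.-1 - i < B)%N by have := ltn_ord i; lia.
  rewrite mxE (bigD1 (Ordinal ltd)) //= big1 ?addr0 => [|d neq].
    by rewrite (newt_null _ _ y1) // (_ : _ == _) ?mul1r //; have := ltn_ord i; lia.
  rewrite (newt_null _ _ y1) // (_ : _ == _ = false) ?mul0r //.
  by apply: contraNF neq; rewrite -val_eqE /=; have := ltn_ord i; lia.
rewrite -det_mulmx (det_upper_block lekN).
  congr (_ * _).
    congr (\det _); apply/matrixP => i m; rewrite !mxE.
    by apply: eq_bigr => j _; rewrite !mxE /= ltn_ord mulrC.
  apply: eq_bigr => i leki; rewrite mxE.
  transitivity (\sum_j 'C(l j + (N.-1 - i), (N.-1 - i).*2.+1)%:R *
    (lweight j * (l j)%:R ^+ (2 * i))).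
    apply: eq_bigr => j _; rewrite [X in X * _]mxE [X in _ * X]mxE ltnNge leki /=.
    by rewrite newton_tail.
  rewrite lweight_bin_sum; last by have := ltn_ord i; lia.
  by rewrite (_ : _ == _) ?mul1r //; have := ltn_ord i; lia.
move=> i m leki ltmi; rewrite mxE.
transitivity (\sum_j 'C(l j + (N.-1 - i), (N.-1 - i).*2.+1)%:R *
    (lweight j * (l j)%:R ^+ (2 * m))).
  apply: eq_bigr => j _; rewrite [X in X * _]mxE [X in _ * X]mxE ltnNge leki /=.
  by rewrite newton_tail.
rewrite lweight_bin_sum; last by have := ltn_ord i; lia.
by rewrite (_ : _ == _ = false) ?mul0r //; have := ltn_ord i; lia.
Qed.
End Determinants.

(** * Euler operators *)

Section Euler.
Variables (F : fieldType) (n : nat) (i : 'I_n).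
Implicit Types f g : {ratfun F[n]}.

Lemma ratfun_quotient f : exists p q, q != 0 /\ f = p%:F / q%:F.
Proof.
by exists \n_(repr f), \d_(repr f); split; [apply: denom_ratioP|apply: frac_repr].
Qed.

Lemma ratderivD f g : ratderiv i (f + g) = ratderiv i f + ratderiv i g.
Proof.
have [p [q [q0 ->]]] := ratfun_quotient f; have [p' [q' [q'0 ->]]] := ratfun_quotient g.
rewrite addf_div ?tofrac_eq0 // -!tofracM -tofracD !ratderiv_eq ?mulf_neq0 //.
rewrite addf_div ?tofrac_eq0 ?expf_neq0 // -!tofracM -tofracD.
apply/eqP; rewrite frac_eq ?(mulf_neq0, expf_neq0) //; apply/eqP.
by rewrite mderivD !mderivM; ring.
Qed.

Lemma ratderivM f g : ratderiv i (f * g) = ratderiv i f * g + f * ratderiv i g.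
Proof.
have [p [q [q0 ->]]] := ratfun_quotient f; have [p' [q' [q'0 ->]]] := ratfun_quotient g.
rewrite mulf_div -!tofracM !ratderiv_eq ?mulf_neq0 //.
rewrite !mulf_div -!tofracM addf_div ?tofrac_eq0 ?(mulf_neq0, expf_neq0) //.
rewrite -!tofracM -tofracD.
apply/eqP; rewrite frac_eq ?(mulf_neq0, expf_neq0) //; apply/eqP.
by rewrite !mderivM; ring.
Qed.

Lemma eulerD f g : euler i (f + g) = euler i f + euler i g.
Proof. by rewrite /euler ratderivD mulrDr. Qed.

Lemma eulerM f g : euler i (f * g) = euler i f * g + f * euler i g.
Proof. by rewrite /euler ratderivM mulrDr mulrA [ratvar i * (f * _)]mulrCA. Qed.

Lemma euler0 : euler i (0 : {ratfun F[n]}) = 0.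
Proof. by apply: (addrI (euler i 0)); rewrite -eulerD !addr0. Qed.

Lemma euler1 : euler i (1 : {ratfun F[n]}) = 0.
Proof. by apply: (addrI (euler i 1)); rewrite addr0 -{3}[1]mulr1 eulerM mul1r mulr1. Qed.

Lemma eulerN f : euler i (- f) = - euler i f.
Proof. by apply/eqP; rewrite -addr_eq0 -eulerD addNr euler0. Qed.

Lemma euler_nat m : euler i (m%:R : {ratfun F[n]}) = 0.
Proof. by elim: m => [|m IHm]; rewrite ?euler0 // mulrS eulerD euler1 IHm addr0. Qed.

Lemma euler_sum (I : Type) (r : seq I) (P : pred I) (f_ : I -> {ratfun F[n]}) :
  euler i (\sum_(j <- r | P j) f_ j) = \sum_(j <- r | P j) euler i (f_ j).
Proof. exact: (big_morph (euler i) eulerD euler0). Qed.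

Lemma eulerV f : f != 0 -> euler i f^-1 = - (euler i f / f ^+ 2).
Proof.
move=> f0; apply: (mulfI f0); apply: (addrI (euler i f / f)).
by rewrite -eulerM divff // euler1 mulrN mulrCA expr2 invfM mulVKf // subrr.
Qed.

Lemma euler_ratvar j : euler i (ratvar j) = (i == j)%:R * ratvar j :> {ratfun F[n]}.
Proof.
rewrite /euler -[X in ratderiv _ X]divr1 -tofrac1 ratderiv_eq ?oner_eq0 //.
rewrite expr1n tofrac1 divr1 mulr1 -mpolyC1 mderivC mulr0 subr0 mderivX mnm1E.
rewrite eq_sym; case: eqVneq => [->|_]; last by rewrite scale0r tofrac0 mulr0 mul0r.
rewrite (_ : (U_(j) - U_(j) = 0 :> 'X_{1..n})%MM); last first.
  by apply/mnmP => r; rewrite mnmBE subnn mnm0E.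
by rewrite mpolyX0 scale1r tofrac1 mulr1 mul1r.
Qed.

Lemma euler_ratvarX m :
  euler i (ratvar i ^+ m) = m%:R * ratvar i ^+ m :> {ratfun F[n]}.
Proof.
elim: m => [|m IHm]; first by rewrite euler1 mul0r.
rewrite exprS eulerM IHm euler_ratvar eqxx mul1r mulrCA -[in RHS]add1n natrD.
by rewrite mulrDl mul1r.
Qed.

Lemma euler_ratvarXV m :
  euler i (ratvar i ^- m) = - (m%:R * ratvar i ^- m) :> {ratfun F[n]}.
Proof.
rewrite eulerV ?expf_neq0 ?ratvar_neq0 // euler_ratvarX -mulrA expr2 invfM.
by rewrite mulVKf ?expf_neq0 ?ratvar_neq0.
Qed.

Lemma eulerM_const f g : euler i f = 0 -> euler i (f * g) = f * euler i g.
Proof. by rewrite eulerM => ->; rewrite mul0r add0r. Qed.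

Lemma euler_constM f g : euler i f = 0 -> euler i g = 0 -> euler i (f * g) = 0.
Proof. by move=> f0 g0; rewrite eulerM_const ?g0 ?mulr0. Qed.

Lemma euler_constV f : euler i f = 0 -> euler i f^-1 = 0.
Proof.
have [->|f0] := eqVneq f 0; first by rewrite invr0.
by move=> e0; rewrite eulerV // e0 mul0r oppr0.
Qed.

Lemma euler_constX f m : euler i f = 0 -> euler i (f ^+ m) = 0.
Proof.
move=> f0; elim: m => [|m IHm]; first exact: euler1.
by rewrite exprS euler_constM.
Qed.

Lemma euler_const_prod (I : Type) (r : seq I) (P : pred I) (f_ : I -> {ratfun F[n]}) :
  (forall j, P j -> euler i (f_ j) = 0) ->
  euler i (\prod_(j <- r | P j) f_ j) = 0.
Proof.
by move=> f0; elim/big_ind: _ => //; [exact: euler1|exact: euler_constM].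
Qed.

Lemma euler_const_ratvar j : i != j -> euler i (ratvar j : {ratfun F[n]}) = 0.
Proof. by rewrite euler_ratvar => /negPf->; rewrite mul0r. Qed.

End Euler.

Lemma pchar_ratfun (F : fieldType) n :
  [pchar F] =i pred0 -> [pchar {ratfun F[n]}] =i pred0.
Proof.
move/pcharf0P => F0; apply/pcharf0P => m.
by rewrite -(rmorph_nat (@FracField.tofrac _)) tofrac_eq0 -mpolyC_nat mpolyC_eq0.
Qed.

(* The operator in column [j] of row [i] only sees the [i]-th factor, so the
   product of operators along a permutation acts factor by factor. *)
Lemma opdet_prod (V : comPzRingType) n (A : 'M[V -> V]_n) (f : 'I_n -> V)
    (g : 'M[V]_n) :
  (forall i j (h : 'I_n -> V), (forall r, h r = f r \/ exists m, h r = g r m) ->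
    A i j (\prod_(r | r != i) h r * f i) = \prod_(r | r != i) h r * g i j) ->
  opdet A (\prod_i f i) = \det g.
Proof.
move=> Aact; apply: eq_bigr => s _; congr (_ * _).
suff step (r : seq 'I_n) : uniq r ->
    (\big[comp/id]_(i <- r) A i (s i)) (\prod_i f i) =
    \prod_i (if i \in r then g i (s i) else f i).
  by rewrite step ?index_enum_uniq //; apply: eq_bigr => i _; rewrite mem_index_enum.
elim: r => [|i r IHr] /=; first by rewrite big_nil; reflexivity.
case/andP=> ir uniq_r; rewrite big_cons /= IHr // [in LHS](bigD1 i) //= (negPf ir) mulrC.
rewrite Aact => [|j]; last by case: ifP; [right; exists (s j)|left].
rewrite [RHS](bigD1 i) //= mem_head mulrC; congr (_ * _).
by apply: eq_bigr => j /negPf neq; rewrite inE neq.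
Qed.

Section EulerSums.
Variables (F : fieldType) (n N : nat) (l : 'I_N -> nat).
Notation x i := (ratvar i : {ratfun F[n]}).
Notation lsum := (@lsum {ratfun F[n]} N l).

Lemma euler_lweight i j : euler i (@lweight {ratfun F[n]} N l j) = 0.
Proof.
apply/euler_constV/euler_constM; first exact: euler_nat.
apply: euler_const_prod => r _; rewrite eulerD eulerN -!natrX !euler_nat.
by rewrite subr0.
Qed.

Lemma euler_const_lsum i j m : i != j -> euler i (lsum m (x j)) = 0.
Proof.
move=> neq; rewrite euler_sum big1 // => r _; apply: euler_constM.
  by rewrite euler_constM ?euler_lweight // -natrX euler_nat.
rewrite eulerD eulerN euler_constX ?euler_const_ratvar //.
by rewrite euler_constV ?subr0 // euler_constX ?euler_const_ratvar.
Qed.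

Lemma euler2_lsum i m : euler i (euler i (lsum m (x i))) = lsum m.+1 (x i).
Proof.
have c0 j : euler i (@lweight {ratfun F[n]} N l j * (l j)%:R ^+ (2 * m)) = 0.
  by rewrite euler_constM ?euler_lweight // -natrX euler_nat.
rewrite !euler_sum; apply: eq_bigr => j _; rewrite !(eulerM_const _ (c0 j)).
rewrite [in RHS]mulnS addnC exprD [in RHS]mulrA -[in RHS]mulrA; congr (_ * _).
rewrite eulerD eulerN euler_ratvarX euler_ratvarXV opprK eulerD.
rewrite !(eulerM_const _ (@euler_nat F n i _)) euler_ratvarX euler_ratvarXV.
by rewrite -mulrDr -mulrBr mulrA -expr2.
Qed.

Lemma iter_euler_lsum i m h : euler i h = 0 ->
  iter (2 * m) (euler i) (h * lsum 0 (x i)) = h * lsum m (x i).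
Proof.
move=> h0; elim: m => // m IHm; rewrite mulnS iterD IHm /=.
by rewrite !(eulerM_const _ h0) euler2_lsum.
Qed.

Lemma opdet_lsum c : (forall i : 'I_n, euler i c = 0) ->
  opdet (\matrix_(i < n, j < n) iter (2 * j) (euler i))
    (\prod_(i < n) (c * lsum 0 (x i))) =
  c ^+ n * \det (\matrix_(i < n, m < n) lsum m (x i)).
Proof.
move=> c0; rewrite -detZ; apply: opdet_prod => i j h hE.
rewrite !mxE [in LHS]mulrA [in RHS]mulrA.
rewrite iter_euler_lsum //; apply: euler_constM => //.
apply: euler_const_prod => r neq; have [->|[m ->]] := hE r; rewrite ?mxE.
  by rewrite euler_constM ?euler_const_lsum // eq_sym.
by rewrite euler_constM ?euler_const_lsum // eq_sym.
Qed.

End EulerSums.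

(** * Symplectic characters *)

Section OddFactorials.
Variables (K : fieldType) (charK : [pchar K] =i pred0).

Definition odd_facts n : K := \prod_(j < n) (j.*2.+1)`!%:R.

Lemma odd_facts_neq0 n : odd_facts n != 0.
Proof. by apply/prodf_neq0 => j _; rewrite (natr_neq0_pchar0 charK) ?fact_gt0. Qed.

Lemma Delta_s1_const n :
  \prod_(1 <= i < n.+1) \prod_(i.+1 <= j < n.+1) (i%:R ^+ 2 - j%:R ^+ 2) *
    (2 ^ n * n`!)%:R = (-1) ^+ 'C(n, 2) * 2 ^+ n * odd_facts n.
Proof.
elim: n => [|n IHn].
  by rewrite /odd_facts big_ord0 big_geq // bin0n /= !expr0 !mulr1.
rewrite /odd_facts big_ord_recr /= -/(odd_facts n) big_nat_recr //=.
rewrite [X in _ * X * _ = _]big_geq // mulr1.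
under eq_big_nat => i /andP[_ ltin] do rewrite big_nat_recr //=.
rewrite big_split /= binS bin1 exprD exprS expnS factS.
have fact_n : \prod_(1 <= i < n.+1) (i%:R ^+ 2 - n.+1%:R ^+ 2) * n.+1%:R =
    (-1) ^+ n * (n.*2.+1)`!%:R :> K.
  have := bin_ffact_squares K n.+1 n.
  rewrite (_ : n.+1 + n = n.*2.+1)%N; last lia.
  rewrite binn mul1r => ->; rewrite mulrCA mulrC; congr (_ * _).
  have -> : (-1) ^+ n = \prod_(1 <= i < n.+1) (-1) :> K by rewrite prodr_const_nat subn1.
  rewrite -big_split /=.
  by apply: eq_bigr => i _; rewrite mulN1r opprB.
transitivity (\prod_(1 <= i < n.+1) \prod_(i.+1 <= j < n.+1) (i%:R ^+ 2 - j%:R ^+ 2) *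
  (2 ^ n * n`!)%:R *
  (\prod_(1 <= i < n.+1) (i%:R ^+ 2 - n.+1%:R ^+ 2) * n.+1%:R) * 2 : K).
  by rewrite !natrM; ring.
rewrite IHn fact_n exprSr.
move: (_`!%:R) (odd_facts n) ((-1) ^+ n) ((-1) ^+ 'C(n, 2)) => a b c d.
by ring.
Qed.

Lemma Delta_s1E N k (x : k.-tuple K) : (forall i, tnth x i != 0) ->
  Delta_s1 N x = Delta_s x * \prod_(i < k) wcoord (tnth x i) ^+ (N - k) *
    ((-1) ^+ 'C(N - k, 2) * 2 ^+ (N - k) * odd_facts (N - k)).
Proof.
move=> x0; rewrite -Delta_s1_const /Delta_s1 mulrA.
have -> // : \prod_(i < k) ((tnth x i - 1) ^+ (2 * (N - k)) / tnth x i ^+ (N - k)) =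
  \prod_(i < k) wcoord (tnth x i) ^+ (N - k).
apply: eq_bigr => i _; rewrite exprM -exprVn -exprMn; congr (_ ^+ _).
by rewrite /wcoord; field; rewrite x0.
Qed.

End OddFactorials.

Lemma Delta_s_neq0 (K : fieldType) k (x : k.-tuple K) : (forall i, tnth x i != 0) ->
  (forall i j, tnth x i * tnth x j != 1) -> injective (tnth x) -> Delta_s x != 0.
Proof.
move=> x0 x1 x_inj; apply: mulf_neq0.
  by apply/prodf_neq0 => i _; rewrite subV_neq0.
apply/prodf_neq0 => i _; apply/prodf_neq0 => j ltij.
have -> : tnth x i + (tnth x i)^-1 - (tnth x j + (tnth x j)^-1) =
    wcoord (tnth x i) - wcoord (tnth x j) by rewrite /wcoord; ring.
rewrite subr_eq0 wcoord_eq // negb_or x1 andbT.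
by apply: contraTneq ltij => /x_inj->; rewrite ltnn.
Qed.

Lemma wcoord_neq0 (K : fieldType) (x : K) : x != 0 -> x * x != 1 -> wcoord x != 0.
Proof.
move=> x0 x1; have w1 : wcoord 1 = 0 :> K by rewrite /wcoord invr1; ring.
rewrite -w1 wcoord_eq ?oner_eq0 // mulr1 orbb; apply: contraNneq x1 => ->.
by rewrite mulr1.
Qed.

Section SymplecticCharacters.
Variables (K : fieldType) (charK : [pchar K] =i pred0).
Variables (N : nat) (lam : N.-tuple nat) (lam_sorted : sorted geq lam).

Definition shifted_part (j : 'I_N) := (tnth lam j + N - j)%N.
Notation l := shifted_part.
Notation odd_facts := (odd_facts K).

Lemma shifted_part_gt0 j : (0 < l j)%N.
Proof. by rewrite /l; have := ltn_ord j; lia. Qed.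

Lemma shifted_part_inj : injective l.
Proof.
have mono (i j : 'I_N) : (i < j)%N -> (l j < l i)%N.
  move=> ltij; have : (tnth lam j <= tnth lam i)%N.
    have geq_trans : transitive geq by move=> a b c /= ab ca; apply: leq_trans ca ab.
    have := sorted_leq_nth geq_trans (fun a => leqnn a) 0%N lam_sorted.
    rewrite !(tnth_nth 0%N) => /(_ i j); rewrite !inE size_tuple !ltn_ord.
    by move=> /(_ isT isT (ltnW ltij)).
  by rewrite /l; have := ltn_ord j; lia.
move=> i j eq_l; apply: val_inj; case: (ltngtP i j) => // /mono; by rewrite eq_l ltnn.
Qed.

Lemma schar1_lsum k (x : k.-tuple K) : (k <= N)%N -> (forall i, tnth x i != 0) ->
  schar1 lam x * (Delta_s x * \prod_(i < k) wcoord (tnth x i) ^+ (N - k)) *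
    \det (lweight_mx K l) =
  \det (\matrix_(i < k, m < k) lsum l m (tnth x i)) / odd_facts (N - k).
Proof.
move=> lekN x0; pose B := \max_j l j.
have leB j : (l j <= B)%N by apply: leq_bigmax.
have leNB := leq_size_bound leB.
pose y i := nth 1 x i.
have yE (i : 'I_k) : y i = tnth x i by rewrite /y (tnth_nth 1).
rewrite (schar1E leB) // -prod_wcoord_Delta_s // [X in X * _]mulrC.
rewrite -det_alternant // => [|i ltik]; last by rewrite -/(y (Ordinal ltik)) yE.
rewrite (det_alternant_lweight charK shifted_part_gt0 shifted_part_inj lekN) //; last first.
  move=> r lekr; rewrite nth_default ?size_tuple //.
  by rewrite /wcoord invr1 (_ : 1 + 1 - 2 = 0) //; ring.
congr (_ * _).
  by congr (\det _); apply/matrixP => i m; rewrite !mxE -yE.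
rewrite (reindex_inj rev_ord_inj) /= /odd_facts -prodfV.
transitivity (\prod_(i < N | (i < N - k)%N) (i.*2.+1)`!%:R^-1 : K).
  apply: eq_big => [i|i _]; first by have := ltn_ord i; lia.
  by rewrite (_ : N.-1 - (N - i.+1) = i)%N //; have := ltn_ord i; lia.
by rewrite (big_ord_narrow (leq_subr k N)).
Qed.

Lemma schar1_nil : schar1 lam ([tuple] : 0.-tuple K) * \det (lweight_mx K l) =
  (odd_facts N)^-1.
Proof.
have := @schar1_lsum 0 [tuple] (leq0n N); rewrite /Delta_s !big_ord0 !mulr1 det_mx00.
by rewrite mul1r subn0; apply; case.
Qed.

Lemma nschar_lsum k (x : k.-tuple K) : (k <= N)%N -> (forall i, tnth x i != 0) ->
  nschar lam x * (Delta_s x * \prod_(i < k) wcoord (tnth x i) ^+ (N - k)) =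
  \det (\matrix_(i < k, m < k) lsum l m (tnth x i)) *
    (odd_facts N / odd_facts (N - k)).
Proof.
move=> lekN x0; have := schar1_nil => e.
have : schar1 lam ([tuple] : 0.-tuple K) * \det (lweight_mx K l) != 0.
  by rewrite e invr_neq0 ?(odd_facts_neq0 charK).
rewrite mulf_eq0 negb_or => /andP[s0 d0].
transitivity (schar1 lam x * (Delta_s x * \prod_(i < k) wcoord (tnth x i) ^+ (N - k)) *
    \det (lweight_mx K l) / (schar1 lam ([tuple] : 0.-tuple K) * \det (lweight_mx K l))).
  by rewrite -mulf_div divff // mulr1 mulrAC.
by rewrite schar1_lsum // e invrK mulrA mulrAC.
Qed.

Lemma nschar1_lsum (x : K) : (0 < N)%N -> x != 0 ->
  nschar lam [tuple x] *
    ((x - x^-1) * (2 - x - x^-1) ^+ (N - 1) / (2 * (2 * N - 1)`!)%:R) =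
  (-1) ^+ (N - 1) / 2 * lsum l 0 x.
Proof.
move=> N0 x0; have := @nschar_lsum 1 [tuple x] N0.
have x'0 i : tnth [tuple x] i != 0 by rewrite ord1.
move=> /(_ x'0); rewrite /Delta_s !big_ord1 big_mkcond big_ord1 /= mulr1 det_mx11 mxE.
have -> : odd_facts N = odd_facts (N - 1) * (2 * N - 1)`!%:R.
  rewrite -{1}(subnK N0) addn1 /odd_facts big_ord_recr /=; congr (_ * _`!%:R); lia.
rewrite [odd_facts (N - 1) * _]mulrC mulfK ?(odd_facts_neq0 charK) //.
rewrite [tnth _ _](_ : _ = x) // => e.
have f0 : (2 * N - 1)`!%:R != 0 :> K by rewrite (natr_neq0_pchar0 charK) ?fact_gt0.
have two0 : 2 != 0 :> K by rewrite (natr_neq0_pchar0 charK).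
have -> : 2 - x - x^-1 = - wcoord x by rewrite /wcoord; ring.
rewrite (exprNn (wcoord x)) natrM; move: e f0.
move: (_`!%:R) (wcoord x ^+ _) (lsum _ _ _) => f w s.
move: (nschar _ _) (_ - _) ((-1) ^+ _) => c y t e f0.
transitivity (c * (y * w) * (t / (2 * f))); first by ring.
by rewrite e; field; rewrite f0 two0.
Qed.

End SymplecticCharacters.

Lemma sign_bin2D (R : pzRingType) m k : (0 < k)%N -> (-1) ^+ 'C(m + k, 2) =
  (-1) ^+ 'C(m, 2) * (-1) ^+ 'C(k, 2) * ((-1) ^+ (m + k - 1)) ^+ k :> R.
Proof.
have -> : ('C(m + k, 2) = 'C(m, 2) + 'C(k, 2) + m * k)%N.
  elim: k => [|k IHk]; first by rewrite addn0 muln0 bin0n !addn0.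
  by rewrite addnS !binS !bin1 IHk; lia.
move=> k0; rewrite !exprD -exprM; congr (_ * _).
rewrite -signr_odd -[RHS]signr_odd; congr (_ ^+ _).
by rewrite !oddM oddB ?oddD; lia.
Qed.

Lemma sign_cancel (K : fieldType) (s s' t p q o o' D E : K) :
  s' * s' = 1 -> t * t = 1 -> s != 0 -> p != 0 -> q != 0 -> D != 0 -> o != 0 ->
  E * (o' / o) =
  s * s' * t * (p * q) * o' / (D * (s * p * o)) * s' * (t / q * E) * D.
Proof.
move=> s2 t2 s0 p0 q0 D0 o0; rewrite -[LHS]mul1r -{1}t2 -[LHS]mul1r -{1}s2.
by field; rewrite ?s0 ?p0 ?q0 ?D0 ?o0.
Qed.

Theorem theorem3p17 (F : fieldType) (charF0 : [pchar F] =i pred0)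
    (N k : nat) (k_ge1 : (1 <= k)%N) (k_leN : (k <= N)%N)
    (lam : N.-tuple nat) (lam_sorted : sorted geq lam) :
  let x (i : 'I_k) : {ratfun F[k]} := ratvar i in
  nschar lam [tuple x i | i < k] =
    Delta_s1 N ([tuple] : 0.-tuple {ratfun F[k]}) / Delta_s1 N [tuple x i | i < k] *
    (-1) ^+ 'C(k, 2) *
    opdet (\matrix_(i < k, j < k) iter (2 * j) (euler i))
      (\prod_(i < k)
        (nschar lam [tuple x i] *
         ((x i - (x i)^-1) * (2 - x i - (x i)^-1) ^+ (N - 1) /
          (2 * (2 * N - 1)`!)%:R))).
Proof.
move=> x; have charK := pchar_ratfun k charF0.
set X := [tuple x i | i < k].
have XE i : tnth X i = x i by rewrite tnth_mktuple.
have X0 i : tnth X i != 0 by rewrite XE ratvar_neq0.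
have X1 i j : tnth X i * tnth X j != 1 by rewrite !XE ratvarM_neq1.
have X_inj : injective (tnth X) by move=> i j; rewrite !XE; apply: ratvar_inj.
have N0 : (0 < N)%N by apply: leq_trans k_leN.
rewrite (eq_bigr _ (fun i _ => nschar1_lsum charK lam_sorted N0 (ratvar_neq0 _ i))).
rewrite opdet_lsum => [|i]; last first.
  by rewrite euler_constM ?euler_constX ?eulerN ?euler1 ?oppr0 ?euler_constV ?euler_nat.
have D0 : Delta_s X * \prod_(i < k) wcoord (tnth X i) ^+ (N - k) != 0.
  rewrite mulf_neq0 ?Delta_s_neq0 //.
  by apply/prodf_neq0 => i _; rewrite expf_neq0 ?wcoord_neq0.
rewrite !Delta_s1E // => [|[]//].
have -> : Delta_s ([tuple] : 0.-tuple {ratfun F[k]}) = 1 by rewrite /Delta_s !big_ord0 mulr1.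
rewrite big_ord0 subn0 !mul1r; apply: (mulIf D0).
rewrite nschar_lsum //.
have -> : \matrix_(i < k, m < k) lsum (shifted_part lam) m (tnth X i) =
  \matrix_(i < k, m < k) lsum (shifted_part lam) m (x i).
  by apply/matrixP => i m; rewrite !mxE XE.
have sN : (-1) ^+ 'C(N, 2) = (-1) ^+ 'C(N - k, 2) * (-1) ^+ 'C(k, 2) *
    ((-1) ^+ (N - 1)) ^+ k :> {ratfun F[k]}.
  by rewrite -{1}(subnK k_leN) sign_bin2D // subnK.
have pN : 2 ^+ N = 2 ^+ (N - k) * 2 ^+ k :> {ratfun F[k]} by rewrite -exprD subnK.
rewrite expr_div_n sN pN.
have signK m : (-1) ^+ m * (-1) ^+ m = 1 :> {ratfun F[k]}.
  by rewrite -exprMn mulrNN mulr1 expr1n.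
apply: sign_cancel (signK _) _ _ _ _ D0 (odd_facts_neq0 charK (N - k)).
- by rewrite -exprMn signK expr1n.
- by rewrite signr_eq0.
- by rewrite expf_neq0 ?(natr_neq0_pchar0 charK).
- by rewrite expf_neq0 ?(natr_neq0_pchar0 charK).
Qed.
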